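(* Let $n\ge2$ and $0\le\ell\le n/2$. Given any $A\in\mathcal{S}_{n-1}$, the equation $$\mathcal{L}(f,g)(z,\bar z,u)=A(z,\bar z,w,\bar w)\big|_{w=u+i\langle z,\bar z\rangle_\ell},$$ for $(f,g)=(f_1,\dots,f_n,g)$ an $(n+1)$-tuple of complex formal power series in $(z,w)\in\mathbb{C}^n\times\mathbb{C}$ without constant terms satisfying $$\frac{\partial(f,g)}{\partial(z,w)}(0)=0,\qquad\operatorname{Re}\Big(\frac{\partial^2g}{\partial w^2}\Big)(0)=0,$$ has only the trivial solution $(f,g)\equiv0$; that is, if such an $(f,g)$ satisfies the equation, then $(f,g)\equiv0$.
   Context: Notation: $\langle a,b\rangle_\ell:=-\sum_{j=1}^{\ell}a_jb_j+\sum_{j=\ell+1}^n a_jb_j$ for $a,b\in\mathbb{C}^n$. The Chern–Moser operator is $$\mathcal{L}(f,g):=\operatorname{Im}\big(g(z,w)-2i\langle\bar z,f(z,w)\rangle_\ell\big)\big|_{w=u+i\langle z,\bar z\rangle_\ell},$$ a real formal power series in $(z,\bar z,u)\in\mathbb{C}^n\times\mathbb{C}^n\times\mathbb{R}$. When $w=u+i\langle z,\bar z\rangle_\ell$ is substituted, $\bar w=u-i\langle z,\bar z\rangle_\ell$. $\mathcal{O}$ is the space of real-valued formal power series in $(z,\bar z,w,\bar w)$ vanishing of order at least $2$ at $0$. A formal power series is expanded as $A(z,\bar z,w,\bar w)=\sum_{\mu,\nu,\gamma,\delta}A_{\mu\nu\gamma\delta}(z,\bar z)w^\gamma\bar w^\delta$,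 where $A_{\mu\nu\gamma\delta}$ is a bihomogeneous polynomial in $(z,\bar z)$ of bidegree $(\mu,\nu)$. The rank $\mathrm{R}(B)$ of a formal power series $B(Z,\bar Z)$ is $\dim_{\mathbb{C}}\operatorname{span}_{\mathbb{C}}\{\frac{\partial^\alpha B}{\partial\bar Z^\alpha}(Z,0)\}_\alpha$, $\alpha$ running over all multi-indices. For every positive integer $k$, $\mathcal{S}_k\subset\mathcal{O}$ is the set of all real-valued formal power series $A(z,\bar z,w,\bar w)$ such that $A_{\mu\nu\gamma\delta}=0$ if $\nu+\delta\le1$, and $\mathrm{R}(A_{\mu\nu\gamma\delta})\le k$ if $\delta\le1$. Equivalently: for each fixed $(\mu,\nu,\gamma,\delta)$ with $\delta\le1$, one can write $A_{\mu\nu\gamma\delta}(z,\bar z)w^\gamma\bar w^\delta=\sum_{j=1}^k\phi_j(z,w)\overline{\psi_j(z,w)}$ for some holomorphic polynomials $\phi_j,\psi_j$ with no constant or linear terms. *)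

(* Defs.v *)
From HB Require Import structures.
From mathcomp Require Import all_boot all_order all_algebra.
From mathcomp Require Import boolp reals.
From mathcomp Require Import complex mpoly.

Set Implicit Arguments.
Unset Strict Implicit.
Unset Printing Implicit Defensive.

Import Order.TTheory GRing.Theory Num.Theory.

Local Open Scope ring_scope.

(* A formal power series in p variables is its coefficient function. *)
Definition fps (R : Type) (p : nat) : Type := 'X_{1..p} -> R.

Section FpsZmodule.
Variables (R : nzRingType) (p : nat).
Implicit Types (F G : fps R p) (m : 'X_{1..p}).

HB.instance Definition _ := gen_eqMixin (fps R p).
HB.instance Definition _ := gen_choiceMixin (fps R p).

Definition fps_zero : fps R p := fun=> 0.
Definition fps_opp F : fps R p := fun m => - F m.
Definition fps_add F G : fps R p := fun m => F m + G m.
Definition fps_scale (c : R) F : fps R p := fun m => c * F m.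

Fact fps_addA : associative fps_add.
Proof. by move=> F G H; apply/funext => m; rewrite /fps_add addrA. Qed.
Fact fps_addC : commutative fps_add.
Proof. by move=> F G; apply/funext => m; rewrite /fps_add addrC. Qed.
Fact fps_add0 : left_id fps_zero fps_add.
Proof. by move=> F; apply/funext => m; rewrite /fps_add add0r. Qed.
Fact fps_addN : left_inverse fps_zero fps_opp fps_add.
Proof. by move=> F; apply/funext => m; rewrite /fps_add addNr. Qed.

HB.instance Definition _ :=
  GRing.isZmodule.Build (fps R p) fps_addA fps_addC fps_add0 fps_addN.

Lemma fps_addE F G m : (F + G) m = F m + G m. Proof. by []. Qed.

Fact fps_scaleA c d F : fps_scale c (fps_scale d F) = fps_scale (c * d) F.
Proof. by apply/funext => m; rewrite /fps_scale mulrA. Qed.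
Fact fps_scale1 : left_id 1 fps_scale.
Proof. by move=> F; apply/funext => m; rewrite /fps_scale mul1r. Qed.
Fact fps_scaleDr : right_distributive fps_scale +%R.
Proof.
by move=> c F G; apply/funext => m; rewrite /fps_scale fps_addE mulrDr.
Qed.
Fact fps_scaleDl F : {morph fps_scale^~ F : c d / c + d}.
Proof.
by move=> c d; apply/funext => m; rewrite fps_addE /fps_scale mulrDl.
Qed.

HB.instance Definition _ := GRing.Zmodule_isLmodule.Build R (fps R p)
  fps_scaleA fps_scale1 fps_scaleDr fps_scaleDl.

End FpsZmodule.

Section FpsRing.
Variables (R : comNzRingType) (p : nat).
Implicit Types (F G : fps R p) (m : 'X_{1..p}).

Definition fps_one : fps R p := fun m => (m == 0%MM)%:R.
Definition fps_mul F G : fps R p := fun m =>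
  \sum_(k : 'X_{1..p < (mdeg m).+1, (mdeg m).+1} | m == (k.1 + k.2)%MM)
    F k.1 * G k.2.

Definition fps_trunc d F : {mpoly R[p]} :=
  \sum_(k : 'X_{1..p < d}) F k *: 'X_[k].

Lemma mcoeff_fps_trunc d F m : (mdeg m < d)%N -> (fps_trunc d F)@_m = F m.
Proof. by move=> lt_m_d; rewrite /fps_trunc mcoeff_mpoly. Qed.

Lemma mcoeffM_congr (P P' Q Q' : {mpoly R[p]}) m :
  (forall k, (mdeg k <= mdeg m)%N -> P@_k = P'@_k) ->
  (forall k, (mdeg k <= mdeg m)%N -> Q@_k = Q'@_k) ->
  (P * Q)@_m = (P' * Q')@_m.
Proof.
move=> hP hQ; rewrite !mcoeffM; apply: eq_bigr => k _.
by rewrite hP ?hQ // -ltnS bmdeg.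
Qed.

Lemma fps_mulE d F G m : (mdeg m < d)%N ->
  fps_mul F G m = (fps_trunc d F * fps_trunc d G)@_m.
Proof.
move=> lt_m_d; rewrite mcoeffM; apply: eq_bigr => k _.
by rewrite !mcoeff_fps_trunc //; apply: leq_trans lt_m_d; apply: bmdeg.
Qed.

Lemma mcoeff_trunc_fps_mul d F G m : (mdeg m < d)%N ->
  (fps_trunc d (fps_mul F G))@_m = (fps_trunc d F * fps_trunc d G)@_m.
Proof. by move=> lt_m_d; rewrite mcoeff_fps_trunc // (fps_mulE _ _ lt_m_d). Qed.

Fact fps_mulA : associative fps_mul.
Proof.
move=> F G H; apply/funext => m; have lt_m := ltnSn (mdeg m).
rewrite !(fps_mulE _ _ lt_m).
rewrite (mcoeffM_congr (P' := fps_trunc (mdeg m).+1 F)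
  (Q' := fps_trunc (mdeg m).+1 G * fps_trunc (mdeg m).+1 H)) //; last first.
  by move=> k le_k; rewrite mcoeff_trunc_fps_mul.
rewrite mulrA; apply: mcoeffM_congr => // k le_k.
by rewrite mcoeff_trunc_fps_mul.
Qed.

Fact fps_mulC : commutative fps_mul.
Proof.
move=> F G; apply/funext => m; have lt_m := ltnSn (mdeg m).
by rewrite !(fps_mulE _ _ lt_m) mulrC.
Qed.

Fact fps_mul1 : left_id fps_one fps_mul.
Proof.
move=> F; apply/funext => m; have lt_m := ltnSn (mdeg m).
rewrite (fps_mulE _ _ lt_m) -[RHS](mcoeff_fps_trunc _ lt_m).
rewrite -[in RHS](mul1r (fps_trunc _ F)); apply: mcoeffM_congr => // k le_k.
by rewrite mcoeff_fps_trunc // mcoeff1.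
Qed.

Fact fps_mulD : left_distributive fps_mul +%R.
Proof.
move=> F G H; apply/funext => m; have lt_m := ltnSn (mdeg m).
rewrite fps_addE !(fps_mulE _ _ lt_m) -mcoeffD -mulrDl.
apply: mcoeffM_congr => // k le_k.
by rewrite mcoeffD !mcoeff_fps_trunc.
Qed.

Fact fps_one_neq0 : fps_one != 0.
Proof.
apply/eqP => /(congr1 (fun F : fps R p => F 0%MM)) /eqP.
by rewrite /fps_one eqxx oner_eq0.
Qed.

HB.instance Definition _ := GRing.Zmodule_isComNzRing.Build (fps R p)
  fps_mulA fps_mulC fps_mul1 fps_mulD fps_one_neq0.

Definition fpsX (i : 'I_p) : fps R p := fun m => (m == U_(i)%MM)%:R.

(* The a-th partial derivative; the coefficients are those of [mderivm]. *)
Definition fps_derivm (a : 'X_{1..p}) F : fps R p := fun m =>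
  F (a + m)%MM *+ \prod_(i < p) (a + m)%MM i ^_ a i.

End FpsRing.

(* Substitution of s i for the i-th variable.  It is meant for s i without
   constant term: monomials of F of degree > mdeg m then do not contribute to
   the coefficient of m, so the truncated sum is exact. *)
Definition fps_subst (R : comNzRingType) (p q : nat) (F : fps R p)
    (s : 'I_p -> fps R q) : fps R q := fun m =>
  (\sum_(k : 'X_{1..p < (mdeg m).+1}) F k *: \prod_(i < p) s i ^+ k i) m.

Section SpanDimension.
Variables (K : fieldType) (V : lmodType K).

Definition in_span (I : Type) (v : I -> V) (x : V) : Prop :=
  exists s : seq (K * I), x = \sum_(t <- s) t.1 *: v t.2.

Definition lin_indep (d : nat) (e : 'I_d -> V) : Prop :=
  forall c : 'I_d -> K, \sum_(i < d) c i *: e i = 0 -> forall i, c i = 0.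

(* The span of the (possibly infinite) family v has a basis of d elements. *)
Definition span_has_dim (I : Type) (v : I -> V) (d : nat) : Prop :=
  exists e : 'I_d -> V,
    [/\ forall i, in_span v (e i), lin_indep e & forall a, in_span e (v a)].

End SpanDimension.

Section Monomials.
Variables (p q : nat).

Definition mcat (a : 'X_{1..p}) (b : 'X_{1..q}) : 'X_{1..p + q} :=
  [multinom match split i with inl j => a j | inr j => b j end | i < p + q].
Definition mleft (m : 'X_{1..p + q}) : 'X_{1..p} :=
  [multinom m (lshift q i) | i < p].
Definition mright (m : 'X_{1..p + q}) : 'X_{1..q} :=
  [multinom m (rshift p i) | i < q].

End Monomials.

(* z^a w^c in the variables Z = (z, w). *)
Definition mzw n (a : 'X_{1..n}) (c : nat) : 'X_{1..n + 1} :=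
  mcat a [multinom c | _ < 1].

Definition zvar n (i : 'I_n) : 'I_(n + 1) := lshift 1 i.
Definition wvar n : 'I_(n + 1) := rshift n ord0.

(* <a, b>_l, with the first l terms negative. *)
Definition pairing (A : nzRingType) (n l : nat) (a b : 'I_n -> A) : A :=
  - (\sum_(j < n | (j < l)%N) a j * b j) + \sum_(j < n | (l <= j)%N) a j * b j.

(* Series in (Z, \bar Z), the two groups of p variables in this order. *)
Section Hermitian.
Variables (R : realType) (p : nat).
Local Notation C := R[i].
Implicit Types (F : fps C p) (B : fps C (p + p)).

Definition holo F : fps C (p + p) := fun m =>
  if mright m == 0%MM then F (mleft m) else 0.

Definition fps_conj B : fps C (p + p) := fun m =>
  (B (mcat (mright m) (mleft m)))^*.

Definition fps_Im B : fps C (p + p) := (2 * 'i)^-1 *: (B - fps_conj B).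

Definition real_valued B : Prop := fps_conj B = B.

(* (d^a B / d\bar Z^a)(Z, 0), a series in Z. *)
Definition conj_deriv0 B (a : 'X_{1..p}) : fps C p := fun m =>
  fps_derivm (mcat 0%MM a) B (mcat m 0%MM).

Definition fps_rank B (d : nat) : Prop := span_has_dim (conj_deriv0 B) d.

Definition fps_rank_le B (k : nat) : Prop :=
  exists2 d : nat, (d <= k)%N & fps_rank B d.

End Hermitian.

Section ChernMoser.
Variables (R : realType) (n : nat).
Local Notation C := R[i].

Local Notation series := (fps C ((n + 1) + (n + 1))).

(* A_{mu nu gamma delta}(z, \bar z), where A is the sum over all indices of
   A_{mu nu gamma delta}(z, \bar z) w^gamma \bar w^delta. *)
Definition component (A : series) (mu nu gamma delta : nat) : fps C (n + n) :=
  fun m =>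
    if (mdeg (mleft m) == mu) && (mdeg (mright m) == nu)
    then A (mcat (mzw (mleft m) gamma) (mzw (mright m) delta)) else 0.

Definition classO (A : series) : Prop :=
  real_valued A /\ forall m, (mdeg m < 2)%N -> A m = 0.

Definition classS (k : nat) (A : series) : Prop :=
  [/\ classO A,
      forall mu nu gamma delta : nat, (nu + delta <= 1)%N ->
        component A mu nu gamma delta = 0 &
      forall mu nu gamma delta : nat, (delta <= 1)%N ->
        fps_rank_le (component A mu nu gamma delta) k].

(* Restricted series have the variables z, \bar z, u, in this order. *)
Definition rz (i : 'I_n) : fps C (n + n + 1) := fpsX C (lshift 1 (lshift n i)).
Definition rzbar (i : 'I_n) : fps C (n + n + 1) :=
  fpsX C (lshift 1 (rshift n i)).
Definition ru : fps C (n + n + 1) := fpsX C (rshift (n + n) ord0).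

(* w = u + i<z, \bar z>_l and \bar w = u - i<z, \bar z>_l. *)
Definition rsubst (l : nat) (i : 'I_((n + 1) + (n + 1))) : fps C (n + n + 1) :=
  match split i with
  | inl j => match split j with
             | inl a => rz a
             | inr _ => ru + 'i *: pairing l rz rzbar
             end
  | inr j => match split j with
             | inl a => rzbar a
             | inr _ => ru - 'i *: pairing l rz rzbar
             end
  end.

Definition restrict_w (l : nat) (B : series) : fps C (n + n + 1) :=
  fps_subst B (rsubst l).

Definition zbar (j : 'I_n) : series := fpsX C (rshift (n + 1) (zvar j)).

Definition chern_moser (l : nat) (f : 'I_n -> fps C (n + 1))
    (g : fps C (n + 1)) : fps C (n + n + 1) :=
  restrict_w l
    (fps_Im (holo g - (2 * 'i) *: pairing l zbar (fun j => holo (f j)))).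

End ChernMoser.

(* Main.v *)
Require Import Defs.
From HB Require Import structures.
From mathcomp Require Import all_boot all_order all_algebra.
From mathcomp Require Import boolp reals.
From mathcomp Require Import complex mpoly.
From mathcomp Require Import ring zify.

(** Write h = <z, \bar z>, and let L be the real series whose restriction to
    w = u + i h is the Chern-Moser operator of (f, g).  The hypothesis says that
    L - A vanishes on w = u + i h, \bar w = u - i h.  Put tau = u - i h: then
    \bar w = tau and w = tau + 2 i h, and the series obtained vanishes
    identically in (z, \bar z, tau).  Only its coefficients of tau^0 and tau^1
    are needed.  In bidegree (p, q), where w and \bar w have bidegree (1, 1),
    they read ([restriction_coef0], [restriction_coef1])

      sum_c (L - A)_{c,0} Y^c = 0,
      sum_c (c (L - A)_{c,0} Y^(c-1) + (L - A)_{c,1} Y^c) = 0,   Y = 2 i h,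

    where B_{c,d} is the part of B with w^c \bar w^d.  These are expansions in
    powers of h, and the rank condition on A makes such expansions rigid: a
    nonzero multiple of h has rank at least n ([multiple_hform_eq0]), so an
    expansion with coefficients of rank less than n that is divisible by the
    next power of h has only zero coefficients ([hform_adic_unique]).

    For p >= 2 the terms of L with \bar f and \bar g do not enter the first
    equation, and L_{c,0} is nonzero only for c = q - 1, where it is a
    combination of the \bar z_j f_j, and c = q, where it is given by g; on the
    other hand A_{c,0} = 0 for c >= q - 1 since A has no term of degree at most
    one in (\bar z, \bar w).  Hence all A_{c,0} vanish,
    for p <= 1 by reality, and L_{q-1,0} + Y L_{q,0} = 0 for p >= 2, which says
    that w f_j = z_j g in these degrees.
    The first tau-derivative, simplified by this relation, becomes

      sum_{c < q - 1} A_{c,1} Y^c = L_{0,1} + Y^(q-1) L_{q,0}.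

    For p >= 3 the term L_{0,1} is zero, so rigidity gives L_{q,0} = 0: the
    coefficients of g, and then of f, of degree at least 3 vanish; the pure
    z-terms of g are seen in the first equation for q = 0.  What remains is
    p = 2.  For q = 1 the left side is zero and L_{0,1} only involves
    df/dw(0) = 0.  For q = 2 the equation is A_{0,1} = (g_02 - \bar g_02) h,
    with g_02 the coefficient of w^2, so g_02 is real by the rank bound, and
    the normalization of its real part makes it zero. *)

Set Implicit Arguments.
Unset Strict Implicit.
Unset Printing Implicit Defensive.

Import Order.TTheory GRing.Theory Num.Theory.

Local Open Scope ring_scope.

(** * Coefficients of products and concatenated exponents *)

Lemma mcoeffXM (R : comNzRingType) p (u m : 'X_{1..p}) (S : {mpoly R[p]}) :
  ('X_[u] * S)@_m = if (u <= m)%MM then S@_(m - u) else 0.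
Proof.
have [le_um|nle_um] := boolP (u <= m)%MM.
  by rewrite -{1}(submK le_um) addmC mulrC mcoeffMX.
rewrite mulrC mcoeffMr big1 // => -[k1 k2] /= /eqP def_m; rewrite mcoeffX.
case: eqP => [def_u|]; last by rewrite mulr0.
by case/negP: nle_um; rewrite def_m def_u lem_addr.
Qed.

Section MonomialPairs.
Variables (p q : nat).

Lemma mcatL (a : 'X_{1..p}) (b : 'X_{1..q}) i : mcat a b (lshift q i) = a i.
Proof. by rewrite mnmE (unsplitK (inl i)). Qed.
Lemma mcatR (a : 'X_{1..p}) (b : 'X_{1..q}) i : mcat a b (rshift p i) = b i.
Proof. by rewrite mnmE (unsplitK (inr i)). Qed.
Lemma mleft_mcat (a : 'X_{1..p}) (b : 'X_{1..q}) : mleft (mcat a b) = a.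
Proof. by apply/mnmP => i; rewrite mnmE mcatL. Qed.
Lemma mright_mcat (a : 'X_{1..p}) (b : 'X_{1..q}) : mright (mcat a b) = b.
Proof. by apply/mnmP => i; rewrite mnmE mcatR. Qed.
Lemma mcatK (m : 'X_{1..p + q}) : mcat (mleft m) (mright m) = m.
Proof.
apply/mnmP => i; rewrite -(splitK i); case: (split i) => j /=.
  by rewrite mcatL mnmE.
by rewrite mcatR mnmE.
Qed.
Lemma mcat_inj (a a' : 'X_{1..p}) (b b' : 'X_{1..q}) :
  mcat a b = mcat a' b' -> a = a' /\ b = b'.
Proof.
move=> e; split; first by rewrite -(mleft_mcat a b) e mleft_mcat.
by rewrite -(mright_mcat a b) e mright_mcat.
Qed.
Lemma mcatD (a a' : 'X_{1..p}) (b b' : 'X_{1..q}) :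
  (mcat a b + mcat a' b' = mcat (a + a') (b + b'))%MM.
Proof.
apply/mnmP => i; rewrite mnmDE -(splitK i); case: (split i) => j /=.
  by rewrite !mcatL mnmDE.
by rewrite !mcatR mnmDE.
Qed.
Lemma mdeg_mcat (a : 'X_{1..p}) (b : 'X_{1..q}) :
  mdeg (mcat a b) = (mdeg a + mdeg b)%N.
Proof.
rewrite !mdegE big_split_ord /=; congr addn; apply: eq_bigr => i _.
  exact: mcatL.
exact: mcatR.
Qed.
Lemma mcat00 : mcat 0 0 = 0%MM :> 'X_{1..p + q}.
Proof.
apply/mnmP => i; rewrite -(splitK i); case: (split i) => j /=.
  by rewrite mcatL !mnm0E.
by rewrite mcatR !mnm0E.
Qed.
Lemma mcatU0 i : mcat U_(i) 0 = U_(lshift q i)%MM :> 'X_{1..p + q}.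
Proof.
apply/mnmP => k; rewrite -(splitK k) mnm1E; case: (split k) => j /=.
  by rewrite mcatL mnm1E (inj_eq (@lshift_inj _ _)).
by rewrite mcatR mnm0E eq_lrshift.
Qed.
Lemma mcat0U i : mcat 0 U_(i) = U_(rshift p i)%MM :> 'X_{1..p + q}.
Proof.
apply/mnmP => k; rewrite -(splitK k) mnm1E; case: (split k) => j /=.
  by rewrite mcatL mnm0E eq_rlshift.
by rewrite mcatR mnm1E (inj_eq (@rshift_inj _ _)).
Qed.

End MonomialPairs.

(** * Multiples of a nondegenerate Hermitian form have large rank *)

Section HermitianForm.
Variables (K : idomainType) (n : nat) (eps : 'I_n -> K).

Definition hform : {mpoly K[n + n]} :=
  \sum_j eps j *: 'X_[mcat U_(j) U_(j)].

Lemma mcoeff_hformM (S : {mpoly K[n + n]}) m :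
  (hform * S)@_m =
  \sum_j if (mcat U_(j) U_(j) <= m)%MM then eps j * S@_(m - mcat U_(j) U_(j))
         else 0.
Proof.
rewrite /hform mulr_suml raddf_sum /=; apply: eq_bigr => j _.
by rewrite -scalerAl mcoeffZ mcoeffXM; case: ifP => // _; rewrite mulr0.
Qed.

Lemma mcoeff_hformM_neq0 (S : {mpoly K[n + n]}) a b :
  (hform * S)@_(mcat a b) != 0 ->
  exists j a' b', [/\ a = (a' + U_(j))%MM, b = (b' + U_(j))%MM &
                      S@_(mcat a' b') != 0].
Proof.
rewrite mcoeff_hformM => nz.
have [j ] : exists j, ((mcat U_(j) U_(j) <= mcat a b)%MM) &&
    (S@_(mcat a b - mcat U_(j) U_(j)) != 0).
  apply/existsP; apply: contraR nz => /existsPn h; apply/eqP/big1 => j _.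
  by move: (h j); case: ifP => //= _; rewrite negbK => /eqP ->; rewrite mulr0.
case/andP => le_j; have := submK le_j; set m := (mcat a b - _)%MM.
rewrite -{1}(mcatK m) mcatD => /mcat_inj[ea eb] nz_m.
by exists j, (mleft m), (mright m); rewrite mcatK.
Qed.

(** Compares the exponent differences a - b of z^a \bar z^b in the monomial
    order; the subtractions are moved across to stay among multi-indices. *)
Definition excess_le (m m' : 'X_{1..n + n}) :=
  ((mleft m + mright m')%MM <= (mleft m' + mright m)%MM)%O.

Lemma excess_le_refl : reflexive excess_le.
Proof. by move=> m; rewrite /excess_le lexx. Qed.
Lemma excess_le_total : total excess_le.
Proof. by move=> m m'; exact: le_total. Qed.
Lemma excess_le_trans : transitive excess_le.
Proof.
move=> m2 m1 m3 h12 h23; have := lem_add h12 h23; rewrite /excess_le.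
set a1 := mleft m1; set b1 := mright m1; set a2 := mleft m2.
set b2 := mright m2; set a3 := mleft m3; set b3 := mright m3.
have -> : (a1 + b2 + (a2 + b3) = (a2 + b2) + (a1 + b3))%MM.
  by apply/mnmP => i; rewrite !mnmDE; lia.
have -> : (a2 + b1 + (a3 + b2) = (a2 + b2) + (a3 + b1))%MM.
  by apply/mnmP => i; rewrite !mnmDE; lia.
by rewrite lemc_add2r.
Qed.

Hypothesis eps_neq0 : forall j, eps j != 0.

(** Keep in S only the terms for which the difference a - b is maximal.  For
    those, the product with the form is controlled by Newton polytopes: the
    term whose z_j-degree is largest, multiplied by z_j \bar z_j, cannot cancel,
    and different j give different monomials.  These n monomials of the product
    are the pairs (al j, be j); since no difference of exponents in the product
    exceeds the maximal one, the minor of the coefficient matrix on the rows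
    al and the columns be is triangular for the order of the be j. *)
Lemma hform_mul_triangular (S : {mpoly K[n + n]}) : S != 0 ->
  exists al be : 'I_n -> 'X_{1..n},
  [/\ injective be, forall j, (hform * S)@_(mcat (al j) (be j)) != 0 &
      forall i j, (hform * S)@_(mcat (al i) (be j)) != 0 -> (be i <= be j)%O].
Proof.
move=> nzS.
have [top top_supp top_max] : exists2 t, t \in msupp S &
    forall m, m \in msupp S -> excess_le m t.
  have := nzS; rewrite -msupp_eq0; elim: (msupp S) => // x s ih _.
  have [-> |/eqP/ih [t ts tmax]] := s =P [::].
    exists x; first exact: mem_head.
    by move=> m; rewrite mem_seq1 => /eqP ->; exact: excess_le_refl.
  have [xt|tx] := orP (excess_le_total x t).
    exists t; first by rewrite inE ts orbT.
    by move=> m; rewrite inE => /orP[/eqP -> //|/tmax].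
  exists x; first exact: mem_head.
  move=> m; rewrite inE => /orP[/eqP -> |/tmax h]; first exact: excess_le_refl.
  exact: excess_le_trans h tx.
(* All monomials of S at this level have the same difference of exponents. *)
pose level (m : 'X_{1..n + n}) := (m \in msupp S) && excess_le top m.
have lev_eq m m' : level m -> level m' ->
    (mleft m + mright m' = mleft m' + mright m)%MM.
  case/andP=> ms tm /andP[m's tm']; apply/le_anti/andP; split.
    exact: (excess_le_trans (top_max _ ms)).
  exact: (excess_le_trans (top_max _ m's)).
have max_j j : exists2 m, level m &
    forall m', level m' -> (mleft m' j <= mleft m j)%N.
  have [m] : exists m, [&& level m & all (fun m' => level m' ==>
      (mleft m' j <= mleft m j)%N) (msupp S)].
    have lev_top : level top by rewrite /level top_supp excess_le_refl.
    pose Pm k := has (fun m => level m && (mleft m j == k)) (msupp S).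
    have exP : exists k, Pm k.
      exists (mleft top j); apply/hasP; exists top => //.
      by rewrite lev_top eqxx.
    have ubP k : Pm k -> (k <= \max_(m <- msupp S) mleft m j)%N.
      case/hasP=> m ms /andP[_ /eqP <-].
      exact: (leq_bigmax_seq (F := fun m : 'X_{1..n + n} => mleft m j)).
    case: (ex_maxnP exP ubP) => k /hasP[m ms /andP[lm /eqP mk]] kmax.
    exists m; rewrite lm; apply/allP => m' m's; apply/implyP => lm'.
    by rewrite mk; apply: kmax; apply/hasP; exists m' => //; rewrite lm' /=.
  case/andP=> lm /allP h; exists m => // m' lm'.
  by case/andP: (lm') => m's _; exact: (implyP (h _ m's)).
have [w lev_w w_max] : exists2 w : 'I_n -> 'X_{1..n + n},
    forall j, level (w j) &
    forall j m', level m' -> (mleft m' j <= mleft (w j) j)%N.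
  have [|w /all_and2[]] := @boolp.choice _ _ (fun j m => level m /\
      forall m', level m' -> (mleft m' j <= mleft m j)%N); last by exists w.
  by move=> j; case: (max_j j) => m; exists m.
have lev_rel i j := lev_eq _ _ (lev_w i) (lev_w j).
exists (fun j => mleft (w j) + U_(j))%MM, (fun j => mright (w j) + U_(j))%MM.
split.
- move=> i j e; apply/eqP; apply/negPn/negP => neq_ij.
  have := congr1 (fun m : 'X_{1..n} => m i) (lev_rel i j).
  have := congr1 (fun m : 'X_{1..n} => m i) e.
  rewrite !mnmDE !mnm1E eqxx eq_sym (negbTE neq_ij).
  by have := w_max i _ (lev_w j); lia.
- move=> j; rewrite mcoeff_hformM (bigD1 j) //= big1 ?addr0.
    rewrite -mcatD lem_addl addmK mcatK mulf_neq0 //.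
    by case/andP: (lev_w j); rewrite mcoeff_msupp.
  move=> k neq_kj; case: ifP => // le_k; apply/eqP.
  rewrite mulf_eq0 (negbTE (eps_neq0 k)) /= mcoeff_eq0; apply/negP => m_supp.
  set m := (_ - _)%MM in m_supp.
  have : (m + mcat U_(k) U_(k) =
          mcat (mleft (w j) + U_(j)) (mright (w j) + U_(j)))%MM.
    exact: submK.
  rewrite -{1}(mcatK m) mcatD => /mcat_inj[eL eR].
  have lev_m : level m.
    rewrite /level m_supp /=; apply: (excess_le_trans (andP (lev_w j)).2).
    rewrite /excess_le le_eqVlt; apply/orP; left; apply/eqP/mnmP => i.
    move: (congr1 (fun m : 'X_{1..n} => m i) eL).
    move: (congr1 (fun m : 'X_{1..n} => m i) eR).
    by rewrite !mnmDE; lia.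
  have := w_max j _ lev_m; have := congr1 (fun m : 'X_{1..n} => m j) eL.
  by rewrite !mnmDE !mnm1E eqxx (negbTE neq_kj); lia.
- move=> i j /mcoeff_hformM_neq0[k [a [b [ea eb]]]].
  rewrite -mcoeff_msupp => /top_max h.
  have := excess_le_trans h (andP (lev_w i)).2.
  rewrite /excess_le mleft_mcat mright_mcat => {}h.
  rewrite -(lemc_add2r (a + U_(k))%MM) eb.
  move: h; rewrite -(lemc_add2r (U_(i) + U_(k))%MM).
  congr (_ <= _)%O; apply/mnmP => x; rewrite !mnmDE.
    by lia.
  by have := congr1 (fun m : 'X_{1..n} => m x) ea; rewrite !mnmDE; lia.
Qed.

End HermitianForm.

Section SpanDimension.
Variables (K : fieldType) (V : lmodType K).

Lemma in_span_fin d (e : 'I_d -> V) x :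
  in_span e x -> exists c : 'rV[K]_d, x = \sum_i c 0 i *: e i.
Proof.
case=> s ->; elim: s => [|[c i] s [r def_s]].
  by exists 0; rewrite big_nil big1 // => i _; rewrite mxE scale0r.
exists (r + c *: delta_mx 0 i); rewrite big_cons def_s addrC /=.
rewrite [RHS](eq_bigr (fun j => r 0 j *: e j + (c * (j == i)%:R) *: e j)).
  rewrite big_split /= (bigD1 (F := fun j => (c * _) *: e j) i) //=.
  rewrite eqxx mulr1 [X in _ = _ + (_ + X)]big1 ?addr0 // => j /negbTE ->.
  by rewrite mulr0 scale0r.
by move=> j _; rewrite !mxE eqxx scalerDl.
Qed.

Lemma lin_indep_le_span d k (e : 'I_d -> V) (v : 'I_k -> V) :
  (forall j, in_span e (v j)) -> lin_indep v -> (k <= d)%N.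
Proof.
move=> v_e indep; have [c def_v] := boolp.choice (fun j => in_span_fin (v_e j)).
pose M : 'M[K]_(k, d) := \matrix_j c j.
suff freeM : row_free M by rewrite -(eqP freeM) rank_leq_col.
rewrite -kermx_eq0; suff -> : kermx M = 0 by rewrite eqxx.
apply/matrixP => i j; rewrite [RHS]mxE; move: j.
apply: (indep (fun j => kermx M i j)).
rewrite (eq_bigr (fun j => \sum_l (kermx M i j * M j l) *: e l)) => [|a _].
  rewrite exchange_big big1 //= => l _; rewrite -scaler_suml.
  have := congr1 (fun A : 'M_(k, d) => A i l) (mulmx_ker M).
  by rewrite [LHS]mxE [RHS]mxE => ->; rewrite scale0r.
rewrite def_v scaler_sumr; apply: eq_bigr => l _.
by rewrite scalerA [M a l]mxE.
Qed.

End SpanDimension.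

Section RankOfMultiples.
Variables (R : realType) (n : nat).
Local Notation C := R[i].

Lemma fps_sumE p (I : Type) (r : seq I) (P : pred I) (F : I -> fps C p) m :
  (\sum_(i <- r | P i) F i) m = \sum_(i <- r | P i) F i m.
Proof. by elim/big_rec2: _ => // i y1 y2 _ <-. Qed.

Definition mseries p (P : {mpoly C[p]}) : fps C p := fun m => P@_m.

Lemma conj_deriv0E (B : fps C (n + n)) a m :
  conj_deriv0 B a m = B (mcat m a) *+ \prod_i (a i)`!.
Proof.
rewrite /conj_deriv0 /fps_derivm mcatD add0m addm0; congr (_ *+ _).
rewrite big_split_ord /= big1 ?mul1n => [|i _].
  by apply: eq_bigr => i _; rewrite !mcatR ffactnn.
by rewrite !mcatL mnm0E ffactn0.
Qed.

(** The \bar z-derivatives at \bar z = 0 with multi-indices be j are linearly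
    independent by triangularity: in a vanishing combination, look at the
    largest be i with a nonzero coefficient, in row al i. *)
Lemma multiple_hform_eq0 (eps : 'I_n -> C) (S : {mpoly C[n + n]}) k :
  (forall j, eps j != 0) -> (k < n)%N ->
  fps_rank_le (mseries (hform eps * S)) k -> S = 0.
Proof.
move=> eps_neq0 lt_kn [d le_dk [e [_ _ e_span]]]; apply/eqP.
apply/negPn/negP => /(hform_mul_triangular eps_neq0)[al [be [inj_be diag tri]]].
suff : (n <= d)%N by rewrite leqNgt (leq_ltn_trans le_dk).
apply: (lin_indep_le_span (fun j => e_span (be j))) => c sum0 j.
apply/eqP/negPn/negP => nz_j.
case: (@Order.TotalTheory.arg_maxP _ _ _ j (fun j => c j != 0) be nz_j).
move=> i nz_i i_max; case/negP: nz_i.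
have := congr1 (fun F : fps C n => F (al i)) sum0.
have scaleE (b : C) (F : fps C n) m : (b *: F) m = b * F m by [].
rewrite fps_sumE (bigD1 i) //= big1 ?addr0 => [|l neq_li].
  rewrite scaleE conj_deriv0E [RHS]/(0 : C) => /eqP.
  rewrite mulf_eq0 mulrn_eq0 (negbTE (diag i)).
  case/or3P=> // /eqP prod0; have : (0 < \prod_x (be i x)`!)%N.
    by apply: prodn_gt0 => x; exact: fact_gt0.
  by rewrite prod0.
rewrite scaleE conj_deriv0E; have [-> |nz_l] := eqVneq (c l) 0.
  by rewrite mul0r.
suff /eqP P0 : (hform eps * S)@_(mcat (al i) (be l)) == 0.
  by rewrite /mseries P0 mul0rn mulr0.
apply/negPn/negP => /tri le_il; case/negP: neq_li; apply/eqP/inj_be/le_anti.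
by rewrite le_il [X in X && _](i_max l nz_l).
Qed.

End RankOfMultiples.

Section PowersOfHform.
Variables (R : realType) (n : nat).
Local Notation C := R[i].

(** Rigidity of expansions in powers of a Hermitian form: the coefficient A 0
    is a multiple of the form of too small rank, hence zero; divide by the form
    and repeat. *)
Lemma hform_adic_unique (eps : 'I_n -> C) (c : C) k m
    (A : nat -> {mpoly C[n + n]}) (S : {mpoly C[n + n]}) :
  (forall j, eps j != 0) -> c != 0 -> (k < n)%N ->
  (forall e, (e < m)%N -> fps_rank_le (mseries (A e)) k) ->
  \sum_(e < m) A e * (c *: hform eps) ^+ e = (c *: hform eps) ^+ m * S ->
  (forall e, (e < m)%N -> A e = 0) /\ S = 0.
Proof.
move=> eps_neq0 c_neq0 lt_kn; set Y := c *: hform eps.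
elim: m A => [|m ih] A rkA; first by rewrite big_ord0 expr0 mul1r.
rewrite big_ord_recl /= expr0 mulr1 => sumE.
pose T := \sum_(e < m) A e.+1 * Y ^+ e.
have sumT : \sum_(e < m) A (bump 0 e) * Y ^+ bump 0 e = Y * T.
  by rewrite mulr_sumr; apply: eq_bigr => e _; rewrite exprS mulrCA.
rewrite sumT in sumE.
have defA0 : A 0%N = hform eps * (c *: (Y ^+ m * S - T)).
  rewrite -[LHS](addrK (Y * T)) sumE exprS -mulrA -mulrBr.
  by rewrite {1}/Y -scalerAl scalerAr.
have : c *: (Y ^+ m * S - T) = 0.
  apply: (multiple_hform_eq0 eps_neq0 lt_kn); rewrite -defA0.
  exact: rkA.
move=> fac0; have A00 : A 0%N = 0 by rewrite defA0 fac0 mulr0.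
move/eqP: fac0; rewrite scaler_eq0 (negbTE c_neq0) subr_eq0 => /eqP/esym defT.
have [A0 S0] := ih (fun e => A e.+1) (fun e => rkA e.+1) defT.
by split=> // -[|e] // /A0.
Qed.

End PowersOfHform.

(** * Substituting polynomials into formal power series *)

Section PolynomialSubstitution.
Variables (R : realType).
Local Notation C := R[i].

Section MseriesMorphism.
Variable p : nat.

Fact mseries_is_additive : additive (@mseries R p).
Proof. by move=> P Q; apply/funext => m; rewrite /mseries mcoeffB. Qed.
HB.instance Definition _ :=
  GRing.isAdditive.Build {mpoly C[p]} (fps C p) (@mseries R p)
    mseries_is_additive.
Fact mseries_is_multiplicative : multiplicative (@mseries R p).
Proof.
split=> [P Q|]; apply/funext => m; last by rewrite /mseries mcoeff1.
by rewrite /mseries mcoeffM.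
Qed.
HB.instance Definition _ :=
  GRing.isMultiplicative.Build {mpoly C[p]} (fps C p) (@mseries R p)
    mseries_is_multiplicative.

Lemma mseriesZ c (P : {mpoly C[p]}) : mseries (c *: P) = c *: mseries P.
Proof. by apply/funext => m; rewrite /mseries mcoeffZ. Qed.
Lemma mseriesX i : mseries 'X_i = fpsX C i :> fps C p.
Proof. by apply/funext => m; rewrite /mseries mcoeffX eq_sym. Qed.

End MseriesMorphism.

Lemma fps_substE p q (F : fps C p) (s : 'I_p -> {mpoly C[q]}) m :
  fps_subst F (fun i => mseries (s i)) m =
  \sum_(k : 'X_{1..p < (mdeg m).+1}) F k * (mmap1 s k)@_m.
Proof.
rewrite /fps_subst fps_sumE; apply: eq_bigr => k _.
rewrite -[LHS]/(F k * _); congr (_ * _); rewrite -[RHS]/(mseries _ m).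
by rewrite rmorph_prod; congr (_ m); apply: eq_bigr => i _; rewrite rmorphXn.
Qed.

(** Bounds the monomials of a substituted monomial for any additive relation
    between exponents, so that gradings and orders of vanishing are treated at
    once. *)
Lemma mmap1_supp p q (T : 'X_{1..q} -> 'X_{1..p} -> Prop)
    (s : 'I_p -> {mpoly C[q]}) :
  T 0%MM 0%MM ->
  (forall m m' k k', T m k -> T m' k' -> T (m + m')%MM (k + k')%MM) ->
  (forall i m, (s i)@_m != 0 -> T m U_(i)%MM) ->
  forall k m, (mmap1 s k)@_m != 0 -> T m k.
Proof.
move=> T0 TD Ts k; pose supp (P : {mpoly C[q]}) k := forall m, P@_m != 0 -> T m k.
have supp1 : supp 1 0%MM.
  by move=> m; rewrite mcoeff1; have [-> |_] := eqVneq m; rewrite ?eqxx.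
have suppM P Q k1 k2 : supp P k1 -> supp Q k2 -> supp (P * Q) (k1 + k2)%MM.
  move=> sP sQ m; rewrite -mcoeff_msupp => /msuppM_le/allpairsP[[m1 m2] /=].
  by rewrite !mcoeff_msupp => -[/sP T1 /sQ T2 ->]; exact: TD.
change (supp (mmap1 s k) k); rewrite [X in supp _ X](multinomUE_id k).
rewrite /mmap1; elim/big_rec2: _ => // i k' P _ sP; apply: (suppM) sP.
elim: (k i) => [|e ih]; first by rewrite expr0 mulm0n.
by rewrite exprS mulmS; apply: suppM ih => m; exact: Ts.
Qed.

Lemma sum_bmnm_widen p (V : nmodType) d d' (F : 'X_{1..p} -> V) : (d <= d')%N ->
  \sum_(k : 'X_{1..p < d}) F k = \sum_(k : 'X_{1..p < d'} | (mdeg k < d)%N) F k.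
Proof.
move=> le_d; pose w (k : 'X_{1..p < d}) : 'X_{1..p < d'} :=
  BMultinom (leq_trans (bmdeg k) le_d).
have w_inj : injective w by move=> k k' /(congr1 val) /= /val_inj.
rewrite -[RHS]big_filter -[LHS]/(\sum_k F (w k)) -(big_map w xpredT F).
apply: perm_big; apply: uniq_perm; rewrite ?map_inj_uniq ?filter_uniq //;
  try exact: index_enum_uniq.
move=> k; rewrite mem_filter mem_index_enum andbT.
apply/mapP/idP => [[k' _ ->]|lt_k]; first exact: (bmdeg k').
by exists (BMultinom lt_k); [exact: mem_index_enum|exact: val_inj].
Qed.

End PolynomialSubstitution.

(** * The restriction in bihomogeneous components *)

Section Restriction.
Variables (R : realType) (n l : nat).
Local Notation C := R[i].
Local Notation series := (fps C ((n + 1) + (n + 1))).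
Local Notation bimon := ('X_{1..(n + 1) + (n + 1)}).
Local Notation M := {mpoly C[n + n]}.

Definition pairing_sign (j : 'I_n) : C := if (j < l)%N then -1 else 1.

Lemma pairing_sign_neq0 j : pairing_sign j != 0.
Proof. by rewrite /pairing_sign; case: ifP; rewrite ?oppr_eq0 oner_eq0. Qed.

Lemma pairing_sign_conj j : (pairing_sign j)^* = pairing_sign j.
Proof. by rewrite /pairing_sign; case: ifP; rewrite ?rmorphN rmorph1. Qed.

Lemma pairingE (V : lalgType C) (a b : 'I_n -> V) :
  pairing l a b = \sum_j pairing_sign j *: (a j * b j).
Proof.
rewrite /pairing [RHS](bigID (fun j : 'I_n => (j < l)%N)) /=; congr (_ + _).
  rewrite -sumrN; apply: eq_bigr => j lt_jl.
  by rewrite /pairing_sign lt_jl scaleN1r.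
apply: eq_big => [j|j le_lj]; first by rewrite leqNgt.
by rewrite /pairing_sign ltnNge le_lj scale1r.
Qed.

Lemma mleftD p q (m m' : 'X_{1..p + q}) :
  mleft (m + m') = (mleft m + mleft m')%MM.
Proof. by apply/mnmP => i; rewrite !(mnmE, mnmDE). Qed.
Lemma mrightD p q (m m' : 'X_{1..p + q}) :
  mright (m + m') = (mright m + mright m')%MM.
Proof. by apply/mnmP => i; rewrite !(mnmE, mnmDE). Qed.

Definition zexp (k : bimon) := mleft (mleft k).
Definition wexp (k : bimon) := mright (mleft k) ord0.
Definition zbarexp (k : bimon) := mleft (mright k).
Definition wbarexp (k : bimon) := mright (mright k) ord0.

(** The grading in which z and \bar z have bidegrees (1, 0) and (0, 1), and w,
    \bar w and u have bidegree (1, 1), as h does: the restriction respects it,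
    and each bidegree only involves finitely many monomials. *)
Definition bideg (k : bimon) : nat * nat :=
  (mdeg (zexp k) + wexp k + wbarexp k, mdeg (zbarexp k) + wexp k + wbarexp k)%N.

Definition rbideg (m : 'X_{1..n + n + 1}) : nat * nat :=
  (mdeg (mleft (mleft m)) + mright m ord0,
   mdeg (mright (mleft m)) + mright m ord0)%N.

Lemma mdeg_mcatK p q (m : 'X_{1..p + q}) :
  mdeg m = (mdeg (mleft m) + mdeg (mright m))%N.
Proof. by rewrite -{1}(mcatK m) mdeg_mcat. Qed.

Lemma mdeg_1 (m : 'X_{1..1}) : mdeg m = m ord0.
Proof. by rewrite mdegE big_ord1. Qed.

Lemma mdeg_bimon (k : bimon) :
  mdeg k = (mdeg (zexp k) + wexp k + mdeg (zbarexp k) + wbarexp k)%N.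
Proof.
rewrite mdeg_mcatK (mdeg_mcatK (mleft k)) (mdeg_mcatK (mright k)) !mdeg_1.
by rewrite addnA.
Qed.

Lemma mdeg_le_bideg k : (mdeg k <= (bideg k).1 + (bideg k).2)%N.
Proof. by rewrite mdeg_bimon /=; lia. Qed.

Lemma mdeg_le_rbideg m : (mdeg m <= (rbideg m).1 + (rbideg m).2)%N.
Proof. by rewrite mdeg_mcatK (mdeg_mcatK (mleft m)) mdeg_1 /=; lia. Qed.

Lemma monK (k : bimon) :
  mcat (mzw (zexp k) (wexp k)) (mzw (zbarexp k) (wbarexp k)) = k.
Proof.
rewrite -[RHS]mcatK -[mleft k in RHS]mcatK -[mright k in RHS]mcatK.
by congr mcat; congr mcat; apply/mnmP => i; rewrite mnmE ord1.
Qed.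

Lemma zexp_mon a c b d : zexp (mcat (mzw a c) (mzw b d)) = a.
Proof. by rewrite /zexp !mleft_mcat. Qed.
Lemma wexp_mon a c b d : wexp (mcat (mzw a c) (mzw b d)) = c.
Proof. by rewrite /wexp mleft_mcat mright_mcat mnmE. Qed.
Lemma zbarexp_mon a c b d : zbarexp (mcat (mzw a c) (mzw b d)) = b.
Proof. by rewrite /zbarexp mright_mcat mleft_mcat. Qed.
Lemma wbarexp_mon a c b d : wbarexp (mcat (mzw a c) (mzw b d)) = d.
Proof. by rewrite /wbarexp !mright_mcat mnmE. Qed.
Definition mon_exp := (zexp_mon, wexp_mon, zbarexp_mon, wbarexp_mon).

Definition psubst (i : 'I_((n + 1) + (n + 1))) : {mpoly C[n + n + 1]} :=
  let h := pairing l (fun j => 'X_(lshift 1 (lshift n j)))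
                     (fun j => 'X_(lshift 1 (rshift n j))) in
  let u := 'X_(rshift (n + n) ord0) in
  match split i with
  | inl j => match split j with
             | inl a => 'X_(lshift 1 (lshift n a))
             | inr _ => u + 'i *: h
             end
  | inr j => match split j with
             | inl a => 'X_(lshift 1 (rshift n a))
             | inr _ => u - 'i *: h
             end
  end.

Lemma mseries_pairing p (a b : 'I_n -> {mpoly C[p]}) :
  mseries (pairing l a b) = pairing l (@mseries R p \o a) (@mseries R p \o b).
Proof.
rewrite /pairing rmorphD rmorphN !rmorph_sum /=.
by congr (- _ + _); apply: eq_bigr => j _; rewrite rmorphM.
Qed.

Lemma mseries_psubst i : mseries (psubst i) = rsubst R l i.
Proof.
have h : mseries (pairing l (fun j => 'X_(lshift 1 (lshift n j)))
  (fun j => 'X_(lshift 1 (rshift n j)))) = pairing l (@rz R n) (@rzbar R n).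
  rewrite mseries_pairing; congr (pairing l _ _); apply/funext => j;
  exact: mseriesX.
rewrite /psubst /rsubst; case: (split i) => j; case: (split j) => a.
- exact: mseriesX.
- by rewrite rmorphD /= mseriesX mseriesZ h.
- exact: mseriesX.
- by rewrite rmorphB /= mseriesX mseriesZ h.
Qed.

Lemma restrict_wE (Q : series) m :
  restrict_w l Q m =
  \sum_(k : 'X_{1..((n + 1) + (n + 1)) < (mdeg m).+1}) Q k * (mmap1 psubst k)@_m.
Proof.
rewrite -[RHS](fps_substE Q psubst) /restrict_w.
by congr (fps_subst Q _ m); apply/funext => i; rewrite mseries_psubst.
Qed.

Lemma bidegD k k' : bideg (k + k') =
  ((bideg k).1 + (bideg k').1, (bideg k).2 + (bideg k').2)%N.
Proof.
rewrite /bideg /zexp /wexp /zbarexp /wbarexp !(mleftD, mrightD) !mdegD !mnmDE.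
by rewrite /=; congr pair; lia.
Qed.

Lemma rbidegD m m' : rbideg (m + m') =
  ((rbideg m).1 + (rbideg m').1, (rbideg m).2 + (rbideg m').2)%N.
Proof.
rewrite /rbideg !(mleftD, mrightD) !mdegD !mnmDE.
by rewrite /=; congr pair; lia.
Qed.

Lemma mleft0 p q : mleft (0%MM : 'X_{1..p + q}) = 0%MM.
Proof. by rewrite -mcat00 mleft_mcat. Qed.
Lemma mright0 p q : mright (0%MM : 'X_{1..p + q}) = 0%MM.
Proof. by rewrite -mcat00 mright_mcat. Qed.
Lemma mleftUl p q i : mleft (U_(lshift q i) : 'X_{1..p + q}) = U_(i)%MM.
Proof. by rewrite -mcatU0 mleft_mcat. Qed.
Lemma mrightUl p q i : mright (U_(lshift q i) : 'X_{1..p + q}) = 0%MM.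
Proof. by rewrite -mcatU0 mright_mcat. Qed.
Lemma mleftUr p q i : mleft (U_(rshift p i) : 'X_{1..p + q}) = 0%MM.
Proof. by rewrite -mcat0U mleft_mcat. Qed.
Lemma mrightUr p q i : mright (U_(rshift p i) : 'X_{1..p + q}) = U_(i)%MM.
Proof. by rewrite -mcat0U mright_mcat. Qed.
Definition mhalf := (mleft0, mright0, mleftUl, mrightUl, mleftUr, mrightUr).

Lemma psubst_supp i m : (psubst i)@_m != 0 ->
  rbideg m = bideg U_(i) /\ (mdeg (U_(i) : bimon) <= mdeg m)%N.
Proof.
have hcoef a : let h := pairing l
      (fun j => 'X_(lshift 1 (lshift n j)) : {mpoly C[n + n + 1]})
      (fun j => 'X_(lshift 1 (rshift n j))) in
    ('X_(rshift (n + n) ord0) + a *: h)@_m != 0 ->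
    rbideg m = (1, 1)%N /\ (1 <= mdeg m)%N.
  rewrite /= mcoeffD mcoeffZ pairingE raddf_sum /= mcoeffX.
  have [<- _|_] := eqVneq U_(rshift (n + n) ord0)%MM m.
    by rewrite /rbideg mdeg1 !mhalf mdeg0 mnm1E.
  rewrite add0r mulf_eq0 negb_or => /andP[_ nz].
  have [j] : exists j : 'I_n,
      (U_(lshift 1 (lshift n j)) + U_(lshift 1 (rshift n j)))%MM == m.
    apply/existsP; apply: contraR nz => /existsPn no_j; rewrite big1 // => j _.
    by rewrite -mpolyXD mcoeffZ mcoeffX (negbTE (no_j j)) mulr0.
  move=> /eqP <-; rewrite rbidegD mdegD !mdeg1 /rbideg.
  by rewrite !mhalf !mdeg0 !mdeg1 !mnm0E.
have bidegE j : mdeg (U_(j) : bimon) = 1%N by exact: mdeg1.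
have xcoef j : ('X_j : {mpoly C[n + n + 1]})@_m != 0 ->
    m = U_(j)%MM /\ (1 <= mdeg m)%N.
  by rewrite mcoeffX; have [<- _|] := eqVneq U_(j)%MM m; rewrite ?eqxx // mdeg1.
rewrite bidegE /psubst /bideg /zexp /wexp /zbarexp /wbarexp -{2 3 4 5 6 7}(splitK i).
case: (split i) => j; rewrite -{2 3 4 5 6 7}(splitK j); case: (split j) => a /=.
- move=> /xcoef[-> _]; split; last by rewrite mdeg1.
  by rewrite /rbideg !mhalf !mnm0E !mdeg0 !mdeg1.
- by move=> /hcoef[-> ->]; rewrite !mhalf !ord1 !mnm0E mnm1E !mdeg0.
- move=> /xcoef[-> _]; split; last by rewrite mdeg1.
  by rewrite /rbideg !mhalf !mnm0E !mdeg0 !mdeg1.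
- rewrite -scaleNr => /hcoef[-> ->].
  by rewrite !mhalf !ord1 !mnm0E mnm1E !mdeg0.
Qed.

Lemma mmap1_psubst_supp k m : (mmap1 psubst k)@_m != 0 ->
  rbideg m = bideg k /\ (mdeg k <= mdeg m)%N.
Proof.
apply: (mmap1_supp (T := fun m k => rbideg m = bideg k /\ (mdeg k <= mdeg m)%N)).
- rewrite !mdeg0 /rbideg /bideg /zexp /wexp /zbarexp /wbarexp !mhalf.
  by rewrite !mdeg0 !mnm0E.
- move=> m1 m2 k1 k2 [e1 le1] [e2 le2]; rewrite rbidegD bidegD e1 e2 !mdegD.
  by split=> //; lia.
- by move=> i m'; exact: psubst_supp.
Qed.

(** If the restriction vanishes, then so does, as a polynomial in z, \bar z and
    u, what each bihomogeneous part of Q contributes to it.  This reduces the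
    rest to polynomials, where u can be translated. *)
Lemma bihomogeneous_restriction (Q : series) p q :
  restrict_w l Q = 0 ->
  \sum_(k : 'X_{1..((n + 1) + (n + 1)) < (p + q).+1} | bideg k == (p, q))
    Q k *: mmap1 psubst k = 0.
Proof.
move=> Q0; apply/mpolyP => m; rewrite mcoeff0 raddf_sum /=.
have coefE (k : bimon) : (Q k *: mmap1 psubst k)@_m = Q k * (mmap1 psubst k)@_m.
  exact: mcoeffZ.
have [bideg_m|neq_bideg] := eqVneq (rbideg m) (p, q); last first.
  rewrite big1 // => k /eqP bideg_k; rewrite coefE.
  have [->|/mmap1_psubst_supp[e _]] := eqVneq (mmap1 psubst k)@_m 0.
    by rewrite mulr0.
  by rewrite e bideg_k eqxx in neq_bideg.
have le_m : (mdeg m < (p + q).+1)%N.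
  by rewrite ltnS (leq_trans (mdeg_le_rbideg m)) // bideg_m.
have := congr1 (fun F : fps _ _ => F m) Q0; rewrite restrict_wE.
rewrite (sum_bmnm_widen (fun k => Q k * (mmap1 psubst k)@_m) le_m) => sum0.
rewrite -[RHS]sum0 big_mkcond [RHS]big_mkcond; apply: eq_bigr => k _.
rewrite coefE.
have [->|/mmap1_psubst_supp[e le_k]] := eqVneq (mmap1 psubst k)@_m 0.
  by rewrite mulr0 !if_same.
by rewrite -e bideg_m eqxx ltnS le_k.
Qed.

Definition herm : M := hform pairing_sign.
Definition twoih : M := (2 * 'i) *: herm.

(** The substitution u = tau + i h, with tau the variable of the univariate
    polynomials: it turns \bar w into tau and w into tau + 2 i h. *)
Definition shift_values (i : 'I_(n + n + 1)) : {poly M} :=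
  match split i with
  | inl j => ('X_j)%:P
  | inr _ => 'X + ('i *: herm)%:P
  end.

Definition shift_u : {mpoly C[n + n + 1]} -> {poly M} :=
  mmap (polyC \o @mpolyC (n + n) C) shift_values.

HB.instance Definition _ := GRing.RMorphism.copy shift_u
  (mmap (polyC \o @mpolyC (n + n) C) shift_values).

Lemma shift_uX i : shift_u 'X_i = shift_values i.
Proof. by rewrite /shift_u mmapX mmap1U. Qed.
Lemma shift_uz j : shift_u 'X_(lshift 1 j) = ('X_j)%:P.
Proof. by rewrite shift_uX /shift_values (unsplitK (inl j)). Qed.
Lemma shift_uu : shift_u 'X_(rshift (n + n) ord0) = 'X + ('i *: herm)%:P.
Proof. by rewrite shift_uX /shift_values (unsplitK (inr ord0)). Qed.

Lemma shift_uZ a P : shift_u (a *: P) = a%:MP%:P * shift_u P.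
Proof. exact: mmapZ. Qed.

Lemma shift_u_pairing : shift_u (pairing l
  (fun j => 'X_(lshift 1 (lshift n j)) : {mpoly C[n + n + 1]})
  (fun j => 'X_(lshift 1 (rshift n j)))) = herm%:P.
Proof.
rewrite pairingE /herm /hform !rmorph_sum /=; apply: eq_bigr => j _.
rewrite shift_uZ rmorphM /= !shift_uz -!polyCM.
congr polyC; rewrite mul_mpolyC -mpolyXD -[U_(_)%MM]mcatU0.
by rewrite -[U_(rshift _ _)%MM]mcat0U mcatD addm0 add0m.
Qed.

Lemma shift_u_psubst (k : bimon) :
  shift_u (mmap1 psubst k) =
  ('X_[mcat (zexp k) (zbarexp k)])%:P * ('X + twoih%:P) ^+ wexp k *
    'X ^+ wbarexp k.
Proof.
rewrite /mmap1 rmorph_prod /=.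
under eq_bigr => i _ do rewrite rmorphXn /=.
rewrite big_split_ord /= !big_split_ord /= !big_ord1.
have w1 : shift_u (psubst (lshift (n + 1) (rshift n ord0))) = 'X + twoih%:P.
  rewrite /psubst (unsplitK (inl _)) (unsplitK (inr _)) rmorphD /=.
  rewrite shift_uu shift_uZ shift_u_pairing -polyCM mul_mpolyC -addrA -polyCD.
  by rewrite -scalerDl /twoih mulr_natl mulr2n.
have w2 : shift_u (psubst (rshift (n + 1) (rshift n ord0))) = 'X.
  rewrite /psubst (unsplitK (inr _)) (unsplitK (inr _)) rmorphB /=.
  rewrite shift_uu shift_uZ shift_u_pairing -polyCM mul_mpolyC.
  by rewrite addrK.
have z1 j : shift_u (psubst (lshift (n + 1) (lshift 1 j))) = ('X_(lshift n j))%:P.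
  by rewrite /psubst (unsplitK (inl _)) (unsplitK (inl _)) shift_uz.
have z2 j : shift_u (psubst (rshift (n + 1) (lshift 1 j))) = ('X_(rshift n j))%:P.
  by rewrite /psubst (unsplitK (inr _)) (unsplitK (inl _)) shift_uz.
have -> : wexp k = k (lshift (n + 1) (rshift n ord0)) by rewrite /wexp 2!mnmE.
have -> : wbarexp k = k (rshift (n + 1) (rshift n ord0)).
  by rewrite /wbarexp 2!mnmE.
rewrite w1 w2 mulrACA mulrA; congr (_ * _ * _).
rewrite mpolyXE_id big_split_ord /= polyCM !rmorph_prod /=.
congr (_ * _); apply: eq_bigr => j _.
  by rewrite z1 mcatL /zexp 2!mnmE rmorphXn.
by rewrite z2 mcatR /zbarexp 2!mnmE rmorphXn.
Qed.

(** The factor of w^c \bar w^d in the part of bidegree (p, q). *)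
Definition bihom_coef (Q : series) (p q c d : nat) : M :=
  \sum_(k : 'X_{1..((n + 1) + (n + 1)) < (p + q).+1}
        | (bideg k == (p, q)) && (wexp k == c) && (wbarexp k == d))
    Q k *: 'X_[mcat (zexp k) (zbarexp k)].

Lemma mcoeff_bihom_coef Q p q c d m :
  (bihom_coef Q p q c d)@_m =
  if (mdeg (mleft m) + c + d == p)%N && (mdeg (mright m) + c + d == q)%N
  then Q (mcat (mzw (mleft m) c) (mzw (mright m) d)) else 0.
Proof.
set k0 := mcat _ _; rewrite raddf_sum /=.
have termE (k : bimon) : (Q k *: 'X_[mcat (zexp k) (zbarexp k)] : M)@_m =
    Q k * (mcat (zexp k) (zbarexp k) == m)%:R by rewrite mcoeffZ mcoeffX.
have k0P (k : bimon) : wexp k = c -> wbarexp k = d ->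
    mcat (zexp k) (zbarexp k) = m -> k = k0.
  by move=> ec ed em; rewrite -[LHS]monK /k0 -em mleft_mcat mright_mcat ec ed.
have bideg0 : bideg k0 = (mdeg (mleft m) + c + d, mdeg (mright m) + c + d)%N.
  by rewrite /bideg !mon_exp.
rewrite -[_ && _]/((mdeg (mleft m) + c + d, mdeg (mright m) + c + d)%N ==
                   (p, q)) -bideg0.
case: (eqVneq (bideg k0) (p, q)) => [pq|neq_pq].
  have lt_k0 : (mdeg k0 < (p + q).+1)%N.
    by rewrite ltnS (leq_trans (mdeg_le_bideg k0)) // pq.
  rewrite (bigD1 (BMultinom lt_k0)) /=; last by rewrite pq !mon_exp !eqxx.
  rewrite termE !mon_exp mcatK eqxx mulr1 big1 ?addr0 // => k.
  case/andP=> /andP[/andP[_ /eqP ec] /eqP ed] neq_k0; rewrite termE.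
  case: eqP => [/(k0P _ ec ed) e|_]; last by rewrite mulr0.
  by case/eqP: neq_k0; apply: val_inj.
rewrite big1 // => k /andP[/andP[/eqP ek /eqP ec] /eqP ed]; rewrite termE.
case: eqP => [/(k0P _ ec ed) e|_]; last by rewrite mulr0.
by rewrite -e ek eqxx in neq_pq.
Qed.

Lemma sum_bihom_coef (Q : series) p q (d : nat) (F : nat -> M) :
  \sum_(k : 'X_{1..((n + 1) + (n + 1)) < (p + q).+1} | (bideg k == (p, q)) &&
     (wbarexp k == d)) Q k *: 'X_[mcat (zexp k) (zbarexp k)] * F (wexp k) =
  \sum_(c < q.+1) bihom_coef Q p q c d * F c.
Proof.
have lt_w (k : bimon) : bideg k = (p, q) -> (wexp k < q.+1)%N.
  by move/(congr1 snd) => /= <-; lia.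
rewrite (partition_big (fun k : 'X_{1..((n + 1) + (n + 1)) < (p + q).+1} =>
   inord (wexp k) : 'I_q.+1) xpredT) //=.
apply: eq_bigr => c _; rewrite /bihom_coef mulr_suml; apply: eq_big => k.
  rewrite andbAC; congr (_ && _).
  have [/lt_w lt_k|//] := eqVneq (bideg k) (p, q).
  by rewrite -val_eqE /= inordK.
by case/andP => /andP[/eqP/lt_w lt_k _] /eqP <-; rewrite inordK.
Qed.

Lemma restriction_shifted (Q : series) p q : restrict_w l Q = 0 ->
  \sum_(k : 'X_{1..((n + 1) + (n + 1)) < (p + q).+1} | bideg k == (p, q))
    (Q k *: 'X_[mcat (zexp k) (zbarexp k)])%:P *
      ('X + twoih%:P) ^+ wexp k * 'X ^+ wbarexp k = 0.
Proof.
move=> /(bihomogeneous_restriction p q)/(congr1 shift_u).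
rewrite rmorph0 rmorph_sum /= => sum0.
rewrite -[RHS]sum0; apply: eq_bigr => k _.
by rewrite shift_uZ shift_u_psubst !mulrA -polyCM mul_mpolyC.
Qed.

(** Evaluation at tau = 0. *)
Lemma restriction_coef0 (Q : series) p q : restrict_w l Q = 0 ->
  \sum_(c < q.+1) bihom_coef Q p q c 0 * twoih ^+ c = 0.
Proof.
move=> /(restriction_shifted p q)/(congr1 (fun P => P.[0])).
rewrite horner_sum horner0 => sum0; rewrite -[RHS]sum0.
rewrite -(sum_bihom_coef Q p q 0 (fun c => twoih ^+ c)) big_mkcondr.
apply: eq_bigr => k _.
rewrite !(hornerM, hornerXn, horner_exp, hornerD, hornerX, hornerC) add0r.
by case: wbarexp => [|d]; rewrite ?mulr1 // exprS mul0r mulr0.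
Qed.

(** Derivative with respect to tau at tau = 0. *)
Lemma restriction_coef1 (Q : series) p q : restrict_w l Q = 0 ->
  \sum_(c < q.+1) (bihom_coef Q p q c 0 * (twoih ^+ c.-1 *+ c) +
                   bihom_coef Q p q c 1 * twoih ^+ c) = 0.
Proof.
move=> /(restriction_shifted p q)/(congr1 (fun P => P^`().[0])).
rewrite linear_sum linear0 horner_sum horner0 => sum0; rewrite -[RHS]sum0.
rewrite big_split /= -(sum_bihom_coef Q p q 0 (fun c => twoih ^+ c.-1 *+ c)).
rewrite -(sum_bihom_coef Q p q 1 (fun c => twoih ^+ c)) !big_mkcondr -big_split /=.
apply: eq_bigr => k _; rewrite !derivM derivC mul0r add0r derivXn deriv_exp.
rewrite derivD derivX derivC addr0 mul1r.
rewrite !(hornerM, hornerXn, hornerMn, horner_exp, hornerD, hornerX, hornerC).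
rewrite add0r.
case: ifP => _; last by rewrite addr0.
case: (wbarexp k) => [|[|d]] /=; rewrite ?mulr0n ?mulr0 ?addr0 ?mulr1 //.
by rewrite !exprS !mul0r mul0rn !mulr0 addr0.
Qed.


End Restriction.

(** * Coefficients of the Chern-Moser operator *)

Lemma fpsXM (R : realType) p i (F : fps R[i] p) m :
  (fpsX R[i] i * F) m = if (m i != 0)%N then F (m - U_(i))%MM else 0.
Proof.
have lt_m : (mdeg m < (mdeg m).+1)%N by [].
rewrite -[LHS]/(fps_mul _ _ m) (fps_mulE _ _ lt_m).
rewrite (mcoeffM_congr (P' := 'X_i) (Q' := fps_trunc (mdeg m).+1 F)) // => [|k le_k].
  rewrite mcoeffXM lep1mP; case: ifP => // _; rewrite mcoeff_fps_trunc //.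
  by rewrite ltnS mdegB.
by rewrite mcoeff_fps_trunc // mcoeffX eq_sym.
Qed.

Section ChernMoserCoefficients.
Variables (R : realType) (n l : nat).
Local Notation C := R[i].
Local Notation series := (fps C ((n + 1) + (n + 1))).
Local Notation eps := (pairing_sign R l).
Local Notation mon a c b d := (mcat (mzw a c) (mzw b d)).
Variables (f : 'I_n -> fps C (n + 1)) (g : fps C (n + 1)).

(** g - 2 i <\bar z, f>, whose imaginary part restricts to the Chern-Moser
    operator. *)
Definition cm_holo : series :=
  holo g - (2 * 'i) *: pairing l (@zbar R n) (fun j => holo (f j)).

Lemma mzw_eq0 (b : 'X_{1..n}) d : (mzw b d == 0%MM) = (b == 0%MM) && (d == 0%N).
Proof.
rewrite -mcat00; apply/eqP/andP => [/mcat_inj[-> e]|[/eqP-> /eqP->]].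
  have := congr1 (fun m : 'X_{1..1} => m ord0) e.
  by rewrite /= mnmE mnm0E => ->.
by congr mcat; apply/mnmP => i; rewrite mnmE mnm0E.
Qed.

Lemma mzw00 : mzw 0 0 = 0%MM :> 'X_{1..n + 1}.
Proof. by apply/eqP; rewrite mzw_eq0 !eqxx. Qed.

Lemma mzwD (a b : 'X_{1..n}) c d : (mzw a c + mzw b d)%MM = mzw (a + b) (c + d).
Proof.
by rewrite mcatD; congr mcat; apply/mnmP => i; rewrite mnmDE !mnmE.
Qed.

Lemma zbarM_coef (F : fps C (n + 1)) j a c b d :
  (zbar R j * holo F) (mon a c b d) =
  if (b == U_(j)%MM) && (d == 0%N) then F (mzw a c) else 0.
Proof.
rewrite fpsXM mcatR /mzw /zvar mcatL -/(mzw a c) -/(mzw b d).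
have UE : U_(rshift (n + 1) (lshift 1 j))%MM =
    mon 0%MM 0%N U_(j)%MM 0%N :> 'X_{1.._}.
  rewrite -mcat0U; congr mcat.
    exact/esym/mzw00.
  by rewrite -mcatU0; congr mcat; apply/mnmP => i; rewrite mnmE mnm0E.
have [bj0|bj_neq0] /= := eqVneq (b j) 0%N.
  case: eqP => // e; move: bj0; rewrite e mnm1E eqxx; discriminate.
have le_b : (U_(j) <= b)%MM by rewrite lep1mP.
have -> : (mon a c b d - U_(rshift (n + 1) (lshift 1 j)) =
           mon a c (b - U_(j)) d)%MM.
  by rewrite -{1}(submK le_b) -(addn0 d) -mzwD -{1}(addm0 (mzw a c)) -mcatD UE
             -[X in (_ + mcat X _)%MM]mzw00 addmK addn0.
rewrite /holo mright_mcat mleft_mcat mzw_eq0; congr (if _ && _ then _ else _).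
apply/eqP/eqP => [e|->]; last by apply/mnmP => i; rewrite mnmBE subnn mnm0E.
by rewrite -(submK le_b) e add0m.
Qed.

Lemma cm_holo_coef a c b d :
  cm_holo (mon a c b d) =
  (if (b == 0%MM) && (d == 0%N) then g (mzw a c) else 0) -
  2 * 'i * \sum_j eps j *
    (if (b == U_(j)%MM) && (d == 0%N) then f j (mzw a c) else 0).
Proof.
rewrite /cm_holo; set G := pairing _ _ _.
rewrite -[LHS]/(holo g (mon a c b d) - 2 * 'i * G (mon a c b d)).
rewrite {1}/holo mright_mcat mleft_mcat mzw_eq0; congr (_ - _ * _).
rewrite /G /pairing [RHS](bigID (fun j : 'I_n => (j < l)%N)) /=.
set S1 := \sum_(j < n | (j < l)%N) _; set S2 := \sum_(j < n | (l <= j)%N) _.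
rewrite -[LHS]/(- (S1 (mon a c b d)) + S2 (mon a c b d)) /S1 /S2 !fps_sumE.
rewrite -sumrN; congr (_ + _).
  by apply: eq_bigr => j lt_jl; rewrite zbarM_coef /pairing_sign lt_jl mulN1r.
apply: eq_big => [j|j le_lj]; first by rewrite leqNgt.
by rewrite zbarM_coef /pairing_sign ltnNge le_lj mul1r.
Qed.

Lemma cm_holo_coef0 a c : cm_holo (mon a c 0%MM 0%N) = g (mzw a c).
Proof.
rewrite cm_holo_coef !eqxx /= big1 ?mulr0 ?subr0 // => j _.
by rewrite eq_sym mnm1_eq0 mulr0.
Qed.

Lemma cm_holo_coef1 a c j :
  cm_holo (mon a c U_(j)%MM 0%N) = - (2 * 'i * (eps j * f j (mzw a c))).
Proof.
rewrite cm_holo_coef mnm1_eq0 /= sub0r (bigD1 j) //= !eqxx /= big1 ?addr0 //.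
by move=> k neq_kj; rewrite eq_mnm1 eq_sym (negbTE neq_kj) mulr0.
Qed.

Lemma cm_holo_coef_eq0 a c b d : (1 < mdeg b)%N || (0 < d)%N ->
  cm_holo (mon a c b d) = 0.
Proof.
move=> big; have [d0|d_neq0] := eqVneq d 0%N; last first.
  rewrite cm_holo_coef (negbTE d_neq0) andbF big1 ?mulr0 ?subr0 // => j _.
  by rewrite andbF mulr0.
move: big; rewrite d0 orbF => big; rewrite cm_holo_coef eqxx !andbT.
case: eqP => [b0|_]; first by rewrite b0 mdeg0 in big.
rewrite big1 ?mulr0 ?subr0 // => j _.
by case: eqP => [bU|_]; rewrite ?mulr0 //; rewrite bU mdeg1 in big.
Qed.

Lemma cm_coef a c b d : fps_Im cm_holo (mon a c b d) =
  (2 * 'i)^-1 * (cm_holo (mon a c b d) - (cm_holo (mon b d a c))^*).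
Proof.
rewrite -[LHS]/(_ * (cm_holo (mon a c b d) - fps_conj cm_holo (mon a c b d))).
by rewrite /fps_conj mright_mcat mleft_mcat.
Qed.

End ChernMoserCoefficients.

(** * Consequences of the conditions on A *)

Section ClassS.
Variables (R : realType) (n k : nat).
Local Notation C := R[i].
Local Notation series := (fps C ((n + 1) + (n + 1))).
Local Notation mon a c b d := (mcat (mzw a c) (mzw b d)).
Variables (A : series) (hA : classS k A).

Lemma classS_low a c b d : (mdeg b + d <= 1)%N -> A (mon a c b d) = 0.
Proof.
case: hA => _ /(_ (mdeg a) (mdeg b) c d) low _ /low.
move/(congr1 (fun F : fps _ _ => F (mcat a b))).
by rewrite /component mleft_mcat mright_mcat !eqxx.
Qed.

(** By reality of A, the vanishing in (\bar z, \bar w) also holds in (z, w). *)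
Lemma classS_low_conj a c b d : (mdeg a + c <= 1)%N -> A (mon a c b d) = 0.
Proof.
move=> le1; case: hA => -[A_real _] _ _.
rewrite -A_real /fps_conj mright_mcat mleft_mcat.
by rewrite (classS_low _ _ le1) rmorph0.
Qed.

Lemma classS_rank p q c d : (d <= 1)%N ->
  fps_rank_le (mseries (bihom_coef A p q c d)) k.
Proof.
move=> le_d; case: hA => _ _ /(_ (p - c - d)%N (q - c - d)%N c d le_d).
have [/andP[le_p le_q]|out] := boolP ((c + d <= p)%N && (c + d <= q)%N).
  congr (fps_rank_le _ k); apply/funext => m.
  rewrite /mseries mcoeff_bihom_coef /component.
  by congr (if _ && _ then _ else _); lia.
move=> _; exists 0%N => //; exists (fun=> 0); split=> [[]|c' _ []|a] //.
exists [::]; rewrite big_nil; apply/funext => m; rewrite conj_deriv0E /mseries.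
rewrite mcoeff_bihom_coef; case: ifP => [/andP[/eqP ep /eqP eq]|_].
  by case/negP: out; lia.
by rewrite mul0rn.
Qed.

End ClassS.

(** * Solving the equation degree by degree *)

Section Kernel.
Variables (R : realType) (n l : nat).
Local Notation C := R[i].
Local Notation series := (fps C ((n + 1) + (n + 1))).
Local Notation M := {mpoly C[n + n]}.
Local Notation eps := (pairing_sign R l).
Local Notation mon a c b d := (mcat (mzw a c) (mzw b d)).
Local Notation Y := (twoih R n l).
Variables (f : 'I_n -> fps C (n + 1)) (g : fps C (n + 1)).
Variables (A : series) (k : nat) (lt_kn : (k < n)%N) (hA : classS k A).
Hypothesis eq_fgA : chern_moser l f g = restrict_w l A.
Local Notation H := (cm_holo l f g).
Local Notation L := (fps_Im H).
Local Notation cL := (bihom_coef L).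
Local Notation cA := (bihom_coef A).

Let twoi_neq0 : 2 * 'i != 0 :> C.
Proof. by rewrite mulf_neq0 ?pnatr_eq0 ?neq0Ci. Qed.

Lemma restrict_cm_sub : restrict_w l (L - A) = 0.
Proof.
apply/funext => m; have := congr1 (fun F : fps _ _ => F m) eq_fgA.
rewrite /chern_moser !restrict_wE -/H => e.
rewrite -[RHS](subrr (restrict_w l A m)) restrict_wE -{1}e -sumrB.
by apply: eq_bigr => j _; rewrite -mulrBl.
Qed.

Lemma bihom_coefB (Q Q' : series) p q c d :
  bihom_coef (Q - Q') p q c d = bihom_coef Q p q c d - bihom_coef Q' p q c d.
Proof. by rewrite -sumrB; apply: eq_bigr => j _; rewrite -scalerBl. Qed.

Lemma cm_bihom_eq0 p q c : (1 < p)%N -> (c.+1 < q)%N -> cL p q c 0 = 0.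
Proof.
move=> gt_p lt_c; apply/mpolyP => m; rewrite mcoeff0 mcoeff_bihom_coef.
case: ifP => // /andP[/eqP ep /eqP eq]; rewrite cm_coef.
by rewrite !cm_holo_coef_eq0 ?conjC0 ?subr0 ?mulr0 //; lia.
Qed.

Lemma cm_bihom1_eq0 p q c : (2 < p)%N || (0 < c)%N -> cL p q c 1 = 0.
Proof.
move=> big; apply/mpolyP => m; rewrite mcoeff0 mcoeff_bihom_coef.
case: ifP => // /andP[/eqP ep /eqP eq]; rewrite cm_coef.
by rewrite !cm_holo_coef_eq0 ?conjC0 ?subr0 ?mulr0 //; lia.
Qed.

Lemma classS_bihom_low p q c d : (q <= c.+1)%N -> cA p q c d = 0.
Proof.
move=> le_q; apply/mpolyP => m; rewrite mcoeff0 mcoeff_bihom_coef.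
by case: ifP => // /andP[_ /eqP eq]; apply: classS_low hA _ _ _ _ _; lia.
Qed.

(** For p >= 2 the conjugate terms of the operator are absent, and its two
    surviving terms carry the powers Y^r and Y^(r+1); the terms of A carry lower
    powers, so they vanish by rigidity.  The relation left between the terms in
    f and g says that w f_j = z_j g in this bidegree. *)
Lemma coef0_relation p r : (1 < p)%N ->
  (forall c, (c < r)%N -> cA p r.+1 c 0 = 0) /\
  cL p r.+1 r 0 + Y * cL p r.+1 r.+1 0 = 0.
Proof.
move=> gt_p; have := restriction_coef0 p r.+1 restrict_cm_sub.
under eq_bigr => c _ do rewrite bihom_coefB mulrBl.
rewrite sumrB !big_ord_recr /= !classS_bihom_low // !mul0r !addr0.
rewrite big1 ?add0r; last first.
  by move=> c _; rewrite cm_bihom_eq0 ?mul0r /= ?ltnS ?ltn_ord.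
move/eqP; rewrite subr_eq0 exprS [Y * _]mulrC => /eqP/esym sumE.
apply: (hform_adic_unique (eps := eps) (c := 2 * 'i) (k := k)) => //.
- exact: pairing_sign_neq0.
- by move=> c _; exact: classS_rank.
rewrite -/(twoih R n l) sumE mulrDr; congr (_ + _); first by rewrite mulrC.
by rewrite [RHS]mulrA [RHS]mulrC.
Qed.

(** The cases p <= 1 not covered by [coef0_relation] follow from reality. *)
Lemma classS_bihom_wbar0_eq0 p q c : cA p q c 0 = 0.
Proof.
have [le_p|gt_p] := leqP p 1.
  apply/mpolyP => m; rewrite mcoeff0 mcoeff_bihom_coef.
  by case: ifP => // /andP[/eqP ep _]; apply: classS_low_conj hA _ _ _ _ _; lia.
have [/classS_bihom_low //|] := leqP q c.+1; case: q => // r lt_c.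
exact: (coef0_relation r gt_p).1.
Qed.

(** The coefficient of tau^1.  The derivatives of the two terms Y^r and Y^(r+1)
    contribute - r and r + 1 times Y^r L_{r+1,0}, by [coef0_relation]. *)
Lemma coef1_relation p r : (1 < p)%N ->
  \sum_(c < r) cA p r.+1 c 1 * Y ^+ c = cL p r.+1 0 1 + Y ^+ r * cL p r.+1 r.+1 0.
Proof.
move=> gt_p; have := restriction_coef1 p r.+1 restrict_cm_sub.
under eq_bigr => c _ do
  rewrite !bihom_coefB classS_bihom_wbar0_eq0 subr0 mulrBl addrA.
rewrite sumrB big_split /= => /eqP; rewrite subr_eq0 => /eqP sumE.
have -> : \sum_(c < r) cA p r.+1 c 1 * Y ^+ c =
          \sum_(c < r.+2) cA p r.+1 c 1 * Y ^+ c.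
  by rewrite !big_ord_recr /= !classS_bihom_low // !mul0r !addr0.
rewrite -sumE addrC; congr (_ + _).
  rewrite big_ord_recl /= expr0 mulr1 big1 ?addr0 // => c _.
  by rewrite cm_bihom1_eq0 ?mul0r ?orbT.
rewrite !big_ord_recr /= big1 ?add0r => [|c _]; last first.
  by rewrite cm_bihom_eq0 ?mul0r /= ?ltnS ?ltn_ord.
have /eqP := (coef0_relation r gt_p).2; rewrite addr_eq0 => /eqP ->.
case: r {sumE} => [|r]; first by rewrite mulr0n mulr0 add0r mulr1n mulrC.
rewrite /= !mulrnAr exprS [_ *+ r.+2]mulrS.
have -> : - (Y * cL p r.+2 r.+2 0) * Y ^+ r = - (cL p r.+2 r.+2 0 * (Y * Y ^+ r)).
  by ring.
by rewrite mulNrn addrCA addNr addr0 mulrC.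
Qed.

Lemma cm_bihom_coef_g p c a : (0 < c)%N -> (mdeg a + c)%N = p ->
  (cL p c c 0)@_(mcat a 0%MM) = (2 * 'i)^-1 * g (mzw a c).
Proof.
move=> gt_c def_p; rewrite mcoeff_bihom_coef mleft_mcat mright_mcat mdeg0.
rewrite !addn0 def_p !eqxx cm_coef cm_holo_coef0 cm_holo_coef_eq0 ?gt_c ?orbT //.
by rewrite conjC0 subr0.
Qed.

Lemma cm_bihom_coef_f p c a j : (1 < p)%N -> (mdeg a + c)%N = p ->
  (cL p c.+1 c 0)@_(mcat a U_(j)%MM) = - (eps j * f j (mzw a c)).
Proof.
move=> gt_p def_p; rewrite mcoeff_bihom_coef mleft_mcat mright_mcat mdeg1.
rewrite !addn0 add1n def_p !eqxx cm_coef cm_holo_coef1.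
rewrite cm_holo_coef_eq0; last by lia.
by rewrite conjC0 subr0 mulrN mulKf.
Qed.

Lemma cm_bihom1_coef b j q : (mdeg b + 1)%N = q ->
  (cL 2 q 0 1)@_(mcat U_(j)%MM b) = - (eps j * (f j (mzw b 1))^*).
Proof.
move=> def_q; rewrite mcoeff_bihom_coef mleft_mcat mright_mcat mdeg1.
rewrite !addn0 def_q !eqxx cm_coef cm_holo_coef1 cm_holo_coef_eq0 ?orbT // sub0r.
rewrite rmorphN opprK !rmorphM /= conjCi conjC_nat.
by rewrite pairing_sign_conj mulrN mulNr mulrN mulKf.
Qed.

(** The vanishing of the term in g propagates to f by [coef0_relation]. *)
Lemma fg_vanish p r : (1 < p)%N -> cL p r.+1 r.+1 0 = 0 ->
  (forall a, (mdeg a + r.+1)%N = p -> g (mzw a r.+1) = 0) /\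
  (forall j a, (mdeg a + r)%N = p -> f j (mzw a r) = 0).
Proof.
move=> gt_p cL0; split=> [a|j a] def_p; apply/eqP.
  have := cm_bihom_coef_g (ltn0Sn r) def_p; rewrite cL0 mcoeff0 => /esym/eqP.
  by rewrite mulf_eq0 invr_eq0 (negbTE twoi_neq0).
have := (coef0_relation r gt_p).2; rewrite cL0 mulr0 addr0 => cL0'.
have := cm_bihom_coef_f j gt_p def_p; rewrite cL0' mcoeff0 => /esym/eqP.
by rewrite oppr_eq0 mulf_eq0 (negbTE (pairing_sign_neq0 _ _ _)).
Qed.

(** For p >= 3 no conjugate term is left in [coef1_relation], which becomes an
    expansion of a multiple of Y^r to which rigidity applies. *)
Lemma cm_bihom_g_eq0_gt2 p r : (2 < p)%N -> cL p r.+1 r.+1 0 = 0.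
Proof.
move=> gt_p; have := coef1_relation r (ltnW gt_p).
rewrite cm_bihom1_eq0 ?gt_p // add0r.
move=> sumE; apply: (hform_adic_unique (A := fun c => cA p r.+1 c 1)
  (pairing_sign_neq0 R l) twoi_neq0 lt_kn _ sumE).2 => c _.
exact: classS_rank.
Qed.

Lemma cm_bihom1_supp q m : (cL 2 q 0 1)@_m != 0 ->
  exists2 j, m = mcat U_(j)%MM (mright m) & (mdeg (mright m) + 1)%N = q.
Proof.
rewrite mcoeff_bihom_coef; case: ifP => [/andP[/eqP em /eqP eq] _|_]; last first.
  by rewrite eqxx.
have /mdeg1P[j /eqP def_j] : mdeg (mleft m) == 1%N by lia.
by exists j; [rewrite -def_j mcatK|lia].
Qed.

(** The infinitesimal automorphisms f = a w + ..., g = 2 i <z, \bar a> w of the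
    quadric live in this bidegree; they are excluded by df/dw(0) = 0. *)
Lemma cm_bihom_21_eq0 : (forall j, f j (mzw 0 1) = 0) -> cL 2 1 1 0 = 0.
Proof.
move=> f01; have := coef1_relation 0 (ltnSn 1); rewrite big_ord0 expr0 mul1r.
suff -> : cL 2 1 0 1 = 0 by rewrite add0r => <-.
apply/mpolyP => m; rewrite mcoeff0; apply/eqP/negPn/negP => nz.
have [j def_m def_q] := cm_bihom1_supp nz; case/negP: nz.
rewrite def_m cm_bihom1_coef //.
have /eqP -> : mright m == 0%MM by rewrite -mdeg_eq0; lia.
by rewrite f01 rmorph0 mulr0 oppr0.
Qed.

Lemma herm_coef m : (herm R n l)@_m =
  \sum_j eps j * (m == mcat U_(j)%MM U_(j)%MM)%:R.
Proof.
rewrite /herm /hform raddf_sum /=; apply: eq_bigr => j _.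
by rewrite mcoeffZ mcoeffX eq_sym.
Qed.

Lemma herm_swap a b : (herm R n l)@_(mcat a b) = (herm R n l)@_(mcat b a).
Proof.
rewrite !herm_coef; apply: eq_bigr => j _; congr (_ * (nat_of_bool _)%:R).
by apply/eqP/eqP => /mcat_inj[-> ->].
Qed.

Lemma herm_conj m : ((herm R n l)@_m)^* = (herm R n l)@_m.
Proof.
rewrite herm_coef rmorph_sum; apply: eq_bigr => j _.
by rewrite rmorphM /= conjC_nat pairing_sign_conj.
Qed.

Lemma herm_supp m : (herm R n l)@_m != 0 ->
  exists j, m = mcat U_(j)%MM U_(j)%MM.
Proof.
rewrite herm_coef => nz.
have [j /eqP def_m] : exists j : 'I_n, m == mcat U_(j)%MM U_(j)%MM;
  last by exists j.
apply/existsP; apply: contraR nz => /existsPn no_j.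
by rewrite big1 // => j _; rewrite (negbTE (no_j j)) mulr0.
Qed.

Lemma twoihM_cm_bihom_22 : Y * cL 2 2 2 0 = g (mzw 0 2) *: herm R n l.
Proof.
have -> : cL 2 2 2 0 = ((2 * 'i)^-1 * g (mzw 0 2))%:MP.
  apply/mpolyP => m; rewrite mcoeffC; have [->|neq_m] := eqVneq m 0%MM.
    by rewrite -mcat00 cm_bihom_coef_g ?mdeg0 // mulr1.
  rewrite mulr0 mcoeff_bihom_coef; case: ifP => // /andP[/eqP e1 /eqP e2].
  case/eqP: neq_m; apply/eqP; rewrite -mdeg_eq0 mdeg_mcatK; lia.
by rewrite mulrC mul_mpolyC scalerA mulrAC mulVf ?mul1r.
Qed.

(** By [coef0_relation] the part of f in z w is g_02 z w, with g_02 the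
    coefficient of w^2 in g; this term of the operator comes from its
    conjugate. *)
Lemma cm_bihom1_22 : cL 2 2 0 1 = - (g (mzw 0 2))^* *: herm R n l.
Proof.
have fE j k' : eps j * f j (mzw U_(k')%MM 1) =
    g (mzw 0 2) * (herm R n l)@_(mcat U_(k')%MM U_(j)%MM).
  have := (coef0_relation 1 (ltnSn 1)).2; rewrite twoihM_cm_bihom_22.
  move/(congr1 (fun P : M => P@_(mcat U_(k')%MM U_(j)%MM))).
  rewrite mcoeffD mcoeff0 mcoeffZ cm_bihom_coef_f ?mdeg1 // addrC.
  by move/eqP; rewrite subr_eq0 => /eqP.
apply/mpolyP => m; rewrite mcoeffZ mulNr.
have [nz|] := boolP ((cL 2 2 0 1)@_m != 0).
  have [j def_m def_q] := cm_bihom1_supp nz.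
  have /mdeg1P[k' /eqP def_k] : mdeg (mright m) == 1%N by lia.
  rewrite def_m def_k cm_bihom1_coef ?mdeg1 //; congr (- _).
  rewrite herm_swap -(herm_conj (mcat U_(k')%MM _)) -rmorphM -fE rmorphM /=.
  by rewrite pairing_sign_conj.
rewrite negbK => /eqP L0; rewrite L0.
have [->|/herm_supp[j def_m]] := eqVneq (herm R n l)@_m 0.
  by rewrite mulr0 oppr0.
move: L0; rewrite def_m cm_bihom1_coef ?mdeg1 // => /eqP.
rewrite oppr_eq0 => /eqP /(congr1 (@Num.conj C)).
rewrite rmorphM /= conjCK rmorph0.
rewrite pairing_sign_conj fE => /(congr1 (@Num.conj C)).
rewrite rmorphM /= herm_conj rmorph0 => ->.
by rewrite oppr0.
Qed.

(** The tau^1-coefficient in bidegree (2, 2) equates a component of A, of rank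
    less than n, with g_02 - \bar g_02 times the Hermitian form. *)
Lemma g_w2_real : (g (mzw 0 2))^* = g (mzw 0 2).
Proof.
have := coef1_relation 1 (ltnSn 1); rewrite big_ord1 expr0 mulr1 expr1.
rewrite twoihM_cm_bihom_22 cm_bihom1_22 -scalerDl addrC -mul_mpolyC mulrC => defA.
suff : (g (mzw 0 2) - (g (mzw 0 2))^*)%:MP = 0 :> M.
  by move/eqP; rewrite mpolyC_eq0 subr_eq0 => /eqP.
apply: (multiple_hform_eq0 (pairing_sign_neq0 R l) lt_kn).
rewrite -/(herm R n l) -defA; exact: classS_rank.
Qed.

Lemma cm_bihom_22_eq0 : g (mzw 0 2) = 0 -> cL 2 2 2 0 = 0.
Proof.
move=> g0; have /eqP := twoihM_cm_bihom_22; rewrite g0 scale0r mulf_eq0.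
case/orP=> [|/eqP //].
rewrite scaler_eq0 (negbTE twoi_neq0) /= => /eqP herm0.
have [j _] : exists j : 'I_n, true by case: n lt_kn => // n' _; exists ord0.
have := herm_coef (mcat U_(j)%MM U_(j)%MM); rewrite herm0 mcoeff0.
rewrite (bigD1 j) //= eqxx mulr1 big1 ?addr0 => [|j' neq].
  by move/esym/eqP; rewrite (negbTE (pairing_sign_neq0 _ _ _)).
case: eqP => [/mcat_inj[/eqP]|_]; last by rewrite mulr0.
by rewrite eq_mnm1 eq_sym (negbTE neq).
Qed.

Lemma g_coef_w0 a : (1 < mdeg a)%N -> g (mzw a 0) = 0.
Proof.
move=> gt_a; have := restriction_coef0 (mdeg a) 0 restrict_cm_sub.
rewrite big_ord1 expr0 mulr1 bihom_coefB classS_bihom_wbar0_eq0 subr0.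
move/(congr1 (fun P : M => P@_(mcat a 0%MM))); rewrite mcoeff0.
rewrite mcoeff_bihom_coef mleft_mcat mright_mcat mdeg0 !addn0 !eqxx.
rewrite cm_coef cm_holo_coef0 cm_holo_coef_eq0 ?gt_a // conjC0 subr0 => /eqP.
by rewrite mulf_eq0 invr_eq0 (negbTE twoi_neq0) => /eqP.
Qed.

(** Collects the bidegrees (p, r + 1); for p = 2 and r >= 2 there is no monomial
    of this bidegree with w^(r+1). *)
Lemma cm_bihom_g_eq0 p r : (1 < p)%N -> (forall j, f j (mzw 0 1) = 0) ->
  'Re (g (mzw 0 2)) = 0 -> cL p r.+1 r.+1 0 = 0.
Proof.
move=> gt_p f01 re_g; have [|le_p] := ltnP 2 p; first exact: cm_bihom_g_eq0_gt2.
have -> : p = 2%N by lia.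
case: r => [|[|r]]; first exact: cm_bihom_21_eq0.
  by apply: cm_bihom_22_eq0; rewrite -re_g; apply/esym/Creal_ReP/CrealP/g_w2_real.
apply/mpolyP => m; rewrite mcoeff0 mcoeff_bihom_coef.
by case: ifP => // /andP[/eqP e _]; lia.
Qed.

Lemma normalized_solution_trivial :
  (forall j m, (mdeg m < 2)%N -> f j m = 0) ->
  (forall m, (mdeg m < 2)%N -> g m = 0) -> 'Re (g (mzw 0 2)) = 0 ->
  (forall j, f j = 0) /\ g = 0.
Proof.
move=> f_low g_low re_g.
have mzwK (m : 'X_{1..n + 1}) : m = mzw (mleft m) (mright m ord0).
  by rewrite -[LHS]mcatK; congr mcat; apply/mnmP => i; rewrite mnmE ord1.
have degE (m : 'X_{1..n + 1}) : (mdeg (mleft m) + mright m ord0)%N = mdeg m.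
  by rewrite [RHS]mdeg_mcatK mdeg_1.
have cL0 p r : (1 < p)%N -> cL p r.+1 r.+1 0 = 0.
  move=> gt_p; apply: cm_bihom_g_eq0 => // j; apply: f_low.
  by rewrite mdeg_mcat mdeg0 mdeg_1 mnmE.
split=> [j|]; apply/funext => m; have [lt_m|ge_m] := ltnP (mdeg m) 2.
- exact: f_low.
- rewrite {1}(mzwK m).
  exact: (fg_vanish ge_m (cL0 _ (mright m ord0) ge_m)).2 (degE m).
- exact: g_low.
- rewrite {1}(mzwK m); have := degE m; case: (mright m ord0) => [|r] def_m.
    by apply: g_coef_w0; rewrite -(addn0 (mdeg _)) def_m.
  exact: (fg_vanish ge_m (cL0 _ r ge_m)).1 def_m.
Qed.

End Kernel.

Lemma fps_derivm0 (R : numDomainType) p (a : 'X_{1..p}) (F : fps R p) :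
  (fps_derivm a F 0%MM == 0) = (F a == 0).
Proof.
rewrite /fps_derivm addm0 mulrn_eq0; case: eqP => // prod0.
have : (0 < \prod_(i < p) a i ^_ a i)%N.
  by apply: prodn_gt0 => i; rewrite ffactnn fact_gt0.
by rewrite prod0.
Qed.

Theorem theorem2p2 (R : realType) (n l : nat) (hn : (2 <= n)%N)
    (hl : (2 * l <= n)%N)
    (A : fps R[i] ((n + 1) + (n + 1))) (hA : classS n.-1 A)
    (f : 'I_n -> fps R[i] (n + 1)) (g : fps R[i] (n + 1))
    (f0 : forall j, f j 0%MM = 0) (g0 : g 0%MM = 0)
    (df0 : forall j i, fps_derivm U_(i)%MM (f j) 0%MM = 0)
    (dg0 : forall i, fps_derivm U_(i)%MM g 0%MM = 0)
    (ddg0 : 'Re (fps_derivm (U_(wvar n) *+ 2)%MM g 0%MM) = 0)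
    (eq_fgA : chern_moser l f g = restrict_w l A) :
  (forall j, f j = 0) /\ g = 0.
Proof.
have low (F : fps R[i] (n + 1)) : F 0%MM = 0 ->
    (forall i, fps_derivm U_(i)%MM F 0%MM = 0) ->
    forall m, (mdeg m < 2)%N -> F m = 0.
  move=> F0 dF0 m; rewrite ltnS leq_eqVlt ltnS leqn0 mdeg_eq0.
  case/orP=> [/mdeg1P[i /eqP ->]|/eqP -> //].
  by apply/eqP; rewrite -fps_derivm0 dF0.
have lt_n : (n.-1 < n)%N by rewrite prednK // (leq_trans _ hn).
apply: (normalized_solution_trivial lt_n hA eq_fgA) => [j||].
- exact: low.
- exact: low.
have -> : mzw 0 2 = (U_(wvar n) *+ 2)%MM.
  rewrite /wvar -mcat0U mulmS mulm1n mcatD addm0; congr mcat.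
  by apply/mnmP => i; rewrite mnmE mnmDE mnm1E !ord1.
move: ddg0; rewrite /fps_derivm addm0 raddfMn => /eqP; rewrite mulrn_eq0.
case/orP => [/eqP prod0|/eqP //].
have : (0 < \prod_(i < n + 1) (U_(wvar n) *+ 2)%MM i ^_ (U_(wvar n) *+ 2)%MM i)%N.
  by apply: prodn_gt0 => i; rewrite ffactnn fact_gt0.
by rewrite prod0.
Qed.
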